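(* Let $k$ and $i$ be integers with $1\le i\le k/2$, $k\equiv 0\pmod 4$ and $i\equiv 0\pmod 4$. Then for all integers $n\ge 0$, $$S_{k,i}(4n+2)\equiv S_{k,i}(4n+3)\equiv 0\pmod 4.$$
   Context: Write $(a;q)_\infty=\prod_{m\ge 0}(1-aq^m)$, $(a)_\infty=(a;q)_\infty$, and $(a_1,\ldots,a_r;q)_\infty=(a_1;q)_\infty\cdots(a_r;q)_\infty$. For integers $k,i$ with $1\le i\le k/2$, the integers $S_{k,i}(n)$, $n\ge 0$, are given by the generating function $$\sum_{n\ge 0}S_{k,i}(n)q^n=\frac{(-q)_\infty\,(q^i,q^{k-i},q^k;q^k)_\infty}{(q)_\infty}.$$ Combinatorially (an overpartition of $n$ is a partition of $n$ in which the first occurrence of each integer may be overlined): if $i<k/2$, $S_{k,i}(n)$ is the number of overpartitions of $n$ whose non-overlined parts are not congruent to $0,\pm i$ modulo $k$; if $i=k/2$, it is the number of overpartitions of $n$ with no part divisible by $k/2$. *)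

(* Defs.v *)
From mathcomp Require Import all_boot all_order all_algebra.

Set Implicit Arguments.
Unset Strict Implicit.
Unset Printing Implicit Defensive.

Import GRing.Theory.
Local Open Scope ring_scope.

(* Formal power series over the integers: [f : fps] stands for
   \sum_(n >= 0) f n * q^n. *)
Definition fps := nat -> int.

Definition fps_one : fps := fun n => (n == 0)%:R.

Definition fps_mul (f g : fps) : fps :=
  fun n => \sum_(j < n.+1) f j * g (n - j)%N.

(* The first n coefficients of 1 / f, for f with constant term 1, obtained by
   solving f * g = 1 for g n in terms of g 0, ..., g (n - 1). *)
Fixpoint fps_inv_seq (f : fps) (n : nat) : seq int :=
  if n is m.+1 then
    let s := fps_inv_seq f m in
    rcons s ((m == 0)%:R - \sum_(j < m) s`_j * f (m - j)%N)
  else [::].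

Definition fps_inv (f : fps) : fps := fun n => (fps_inv_seq f n.+1)`_n.

(* qpoch c s b is (c q^s; q^b)_oo for b > 0.  The factors with m > n are
   congruent to 1 modulo q^(n+1), so the coefficient of q^n in the infinite
   product is already that of the product over m <= n; see [qpoch_stable]. *)
Definition qpoch (c : int) (s b : nat) : fps :=
  fun n => (\prod_(m < n.+1) (1 - c *: 'X^(s + b * m)%N) : {poly int})`_n.

Definition Sgf (k i : nat) : fps :=
  fps_mul
    (fps_mul (qpoch (-1) 1 1)
       (fps_mul (qpoch 1 i k) (fps_mul (qpoch 1 (k - i)%N k) (qpoch 1 k k))))
    (fps_inv (qpoch 1 1 1)).

Definition Ski (k i n : nat) : int := Sgf k i n.

Lemma qpoch_stable (c : int) (s b n N : nat) : (0 < b)%N -> (n < N)%N ->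
  (\prod_(m < N) (1 - c *: 'X^(s + b * m)%N) : {poly int})`_n = qpoch c s b n.
Proof.
move=> b0; elim: N => // N IH; rewrite ltnS leq_eqVlt => /predU1P[->//|nN].
rewrite big_ord_recr /= mulrBr mulr1 coefB -scalerAr coefZ coefMXn.
have nb : (n < s + b * N)%N.
  by apply: leq_trans nN _; apply: leq_trans (leq_addl _ _); rewrite leq_pmull.
by rewrite nb mulr0 subr0 IH.
Qed.

Lemma qpoch0 (c : int) (s b : nat) : (0 < s)%N -> qpoch c s b 0 = 1.
Proof.
move=> s0; rewrite /qpoch big_ord1 coefB coef1 coefZ coefXn muln0 addn0.
by case: s s0 => // s _; rewrite mulr0 subr0.
Qed.

Lemma size_fps_inv_seq (f : fps) (n : nat) : size (fps_inv_seq f n) = n.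
Proof. by elim: n => //= n IH; rewrite size_rcons IH. Qed.

Lemma nth_fps_inv_seq (f : fps) (n j : nat) :
  (j < n)%N -> (fps_inv_seq f n)`_j = fps_inv f j.
Proof.
elim: n => // n IH; rewrite ltnS leq_eqVlt => /predU1P[->//|jn].
by rewrite /= nth_rcons size_fps_inv_seq jn IH.
Qed.

Lemma fps_mulV (f : fps) : f 0 = 1 -> fps_mul (fps_inv f) f =1 fps_one.
Proof.
move=> f0 n; rewrite /fps_mul big_ord_recr /= subnn f0 mulr1.
rewrite {2}/fps_inv /= nth_rcons size_fps_inv_seq ltnn eqxx.
rewrite [X in _ + (_ - X)](eq_bigr (fun j : 'I_n => fps_inv f j * f (n - j)%N)).
  by rewrite addrC subrK.
by move=> j _; rewrite nth_fps_inv_seq.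
Qed.

(* Main.v *)
(** Since [(1 + q^m) / (1 - q^m) = 1 + 2 (q^m + q^(2m) + ...)], the quotient
    [(-q)_oo / (q)_oo] is congruent to [1 + 2 \sum_(n > 0) d(n) q^n] modulo 4,
    where [d] counts divisors.  The remaining product is a series in [q^4], and
    [d(n)] is even when [n] is 2 or 3 modulo 4, as [n] is then not a square. *)
Require Import Defs.
From mathcomp Require Import all_boot all_order all_algebra.
From mathcomp Require Import zify ring.

Set Implicit Arguments.
Unset Strict Implicit.
Unset Printing Implicit Defensive.

Import GRing.Theory.
Local Open Scope ring_scope.

Section CongruenceModuloTwoElements.
Variables (R : comNzRingType) (a b : R).

(** Congruence modulo the ideal generated by [a] and [b]. With [a = 4] and [b = 'X^N] it compares
    power series modulo 4 up to order [N] through their polynomial truncations. *)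
Definition cong (x y : R) := exists u v, x = y + a * u + b * v.

Lemma cong_refl x : cong x x.
Proof. by exists 0, 0; ring. Qed.

Lemma cong_sym x y : cong x y -> cong y x.
Proof. by case=> u [v ->]; exists (- u), (- v); ring. Qed.

Lemma cong_trans y x z : cong x y -> cong y z -> cong x z.
Proof.
by case=> u [v ->] [u' [v' ->]]; exists (u + u'), (v + v'); ring.
Qed.

Lemma congM x x' y y' : cong x x' -> cong y y' -> cong (x * y) (x' * y').
Proof.
case=> u [v ->] [u' [v' ->]].
exists (u * y' + x' * u' + a * u * u' + b * v * u').
by exists (v * y' + x' * v' + a * u * v' + b * v * v'); ring.
Qed.

Lemma cong_prod (I : Type) (r : seq I) (F G : I -> R) :
  (forall i, cong (F i) (G i)) -> cong (\prod_(i <- r) F i) (\prod_(i <- r) G i).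
Proof.
move=> FG; elim/big_rec2: _ => [|i x y _ xy]; first exact: cong_refl.
exact: congM.
Qed.

End CongruenceModuloTwoElements.

(** On expanding the product, every term that involves two or more of the [G i] carries a factor
    4. *)
Lemma cong_prod_1D2 (R : comNzRingType) (b : R) (I : Type) (r : seq I)
    (G : I -> R) :
  cong 4%:R b (\prod_(i <- r) (1 + 2%:R * G i)) (1 + 2%:R * \sum_(i <- r) G i).
Proof.
elim/big_rec2: _ => [|i x y _ [u [v ->]]]; first by exists 0, 0; ring.
exists (G i * x + u + 2%:R * G i * u), (v + 2%:R * G i * v); ring.
Qed.

Definition trunc (N : nat) (f : fps) : {poly int} := \poly_(j < N) f j.

Lemma cong_coef_eq (a : {poly int}) (N : nat) (p q : {poly int}) :
  (forall j, (j < N)%N -> p`_j = q`_j) -> cong a 'X^N p q.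
Proof.
move=> pq; exists 0, (drop_poly N (p - q)).
rewrite mulr0 addr0 mulrC -[LHS](subrK q) addrC -{1}(poly_take_drop N (p - q)).
suff -> : take_poly N (p - q) = 0 by rewrite add0r.
apply/polyP => j; rewrite coef_take_poly coef0 coefB.
by case: ifP => // /pq ->; rewrite subrr.
Qed.

Lemma cong_coef (N : nat) (p q : {poly int}) (j : nat) :
  cong 4%:R 'X^N p q -> (j < N)%N -> (p`_j = q`_j %[mod 4])%Z.
Proof.
case=> u [v ->] jN; rewrite !coefD coefXnM jN addr0 mulr_natl coefMn.
by rewrite addrC -[u`_j *+ 4]mulr_natr natz modzMDl.
Qed.

Lemma cong_truncM (a : {poly int}) (N : nat) (f g : fps) :
  cong a 'X^N (trunc N (fps_mul f g)) (trunc N f * trunc N g).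
Proof.
apply: cong_coef_eq => j jN; rewrite coef_poly jN coefM.
apply: eq_bigr => l _; rewrite !coef_poly.
by rewrite !ifT //; have := ltn_ord l; lia.
Qed.

Lemma cong_trunc_qpoch (a : {poly int}) (N : nat) (c : int) (s b : nat) :
  (0 < b)%N ->
  cong a 'X^N (trunc N (qpoch c s b))
    (\prod_(m < N) (1 - c *: 'X^(s + b * m))).
Proof.
move=> b0; apply: cong_coef_eq => j jN.
by rewrite coef_poly jN qpoch_stable.
Qed.

(** For [0 < n <= N] the coefficient of ['X^n] is the number of divisors of [n], counted as
    factorisations into two positive factors. *)
Definition divisor_poly (N : nat) : {poly int} :=
  \sum_(m < N) \sum_(j < N) 'X^(m.+1 * j.+1).

(** The quotient of the two products, with the denominator cleared; the congruence holds factor by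
    factor once [1 / (1 - q^m)] is cut to a finite geometric sum. *)
Lemma cong_qpoch_overpartition (N : nat) :
  cong 4%:R 'X^N (trunc N (qpoch (-1) 1 1))
    (trunc N (qpoch 1 1 1) * (1 + 2%:R * divisor_poly N)).
Proof.
apply: cong_trans (cong_trunc_qpoch _ N (-1) 1 (ltn0Sn 0)) _.
apply: cong_sym; apply: cong_trans.
  apply: congM (cong_trunc_qpoch _ N 1 1 (ltn0Sn 0)) (cong_sym (cong_prod_1D2 _ _ _)).
rewrite -big_split /=; apply: cong_prod => m.
rewrite scaleN1r scale1r opprK mul1n add1n.
have geom M : (1 - 'X^(m.+1)) * (\sum_(j < M) 'X^(m.+1 * j.+1))
    = 'X^(m.+1) - 'X^(m.+1 * M.+1) :> {poly int}.
  elim: M => [|M IH]; first by rewrite big_ord0 mulr0 muln1 subrr.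
  rewrite big_ord_recr /= mulrDr IH [(_ * M.+2)%N]mulnS exprD; ring.
(* The telescoped sum leaves the error [- 2 'X^(m.+1 * N.+1)], whose exponent is at least [N]; the
   witness is its quotient by ['X^N]. *)
exists 0, (- 2%:R * 'X^(m.+1 + m * N)).
rewrite mulrDr mulr1 mulrCA geom.
have -> : (m.+1 * N.+1 = N + (m.+1 + m * N))%N by lia.
by rewrite [_ ^+ (N + _)%N]exprD; ring.
Qed.

(** Off the diagonal the entries pair up by symmetry: each induction step adds a row and a column
    with equal sums. *)
Lemma sum_sym_even (f : nat -> nat -> int) (N : nat) :
  (forall m j, f m j = f j m) -> (forall m, f m m = 0) ->
  (2 %| (\sum_(m < N) \sum_(j < N) f m j))%Z.
Proof.
move=> fC f0; elim: N => [|N IH]; first by rewrite big_ord0.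
rewrite big_ord_recr /= [X in _ + X]big_ord_recr /= f0 addr0.
rewrite (eq_bigr (fun m : 'I_N => \sum_(j < N) f m j + f N m)); last first.
  by move=> m _; rewrite big_ord_recr /= fC.
rewrite big_split /= -addrA -mulr2n.
apply: rpredD => //.
by rewrite -[X in X \in _]mulr_natr natz; apply: dvdz_mull.
Qed.

Lemma divisor_poly_even (N n : nat) : (1 < n %% 4)%N ->
  (2 %| (divisor_poly N)`_n)%Z.
Proof.
move=> n4; rewrite coef_sum.
under eq_bigr => m _ do
  (rewrite coef_sum; under eq_bigr => j _ do rewrite coefXn).
apply: (sum_sym_even (f := fun m j => (n == m.+1 * j.+1)%N%:R)).
  by move=> m j; rewrite mulnC.
(* A diagonal term would make [n] a square, and squares are 0 or 1 modulo 4. *)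
move=> m; case: eqP => // nE; move: n4; rewrite nE -modnMm.
by case: (m.+1 %% 4)%N (ltn_pmod m.+1 (isT : 0 < 4)%N) => [|[|[|[|]]]].
Qed.

(** Being a series in [q^d], stated for coefficient sequences so that it covers both [fps] and
    polynomials. *)
Definition supported (d : nat) (f : nat -> int) :=
  forall n, ~~ (d %| n)%N -> f n = 0.

Lemma supported_conv (d : nat) (f g : nat -> int) :
  supported d f -> supported d g ->
  supported d (fun n => \sum_(j < n.+1) f j * g (n - j)%N).
Proof.
move=> df dg n dn; apply: big1 => j _.
have [dj|/df->] := boolP (d %| j)%N; last by rewrite mul0r.
rewrite dg ?mulr0 //; apply: contra dn => dnj.
by rewrite -(subnKC (ltn_ord j : j <= n)%N) dvdn_add.
Qed.

Lemma supported_qpoch (d : nat) (c : int) (s b : nat) :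
  (d %| s)%N -> (d %| b)%N -> supported d (qpoch c s b).
Proof.
move=> ds db n dn; rewrite /qpoch; move: n.+1 => M.
elim: M n dn => [|M IH] n dn.
  rewrite big_ord0 coef1; case: n dn => //.
  by rewrite dvdn0.
rewrite big_ord_recr /= coefM.
apply: (supported_conv IH _ dn) => j dj.
rewrite coefB coef1 coefZ coefXn.
have /negPf-> : j != 0%N by apply: contraNneq dj => ->.
have /negPf-> : j != (s + b * M)%N.
  by apply: contraNneq dj => ->; rewrite dvdn_add // dvdn_mulr.
by rewrite mulr0 subr0.
Qed.

Lemma cong_trunc_Sgf (k i N : nat) :
  cong 4%:R 'X^N (trunc N (Sgf k i))
    (trunc N (fps_mul (qpoch 1 i k) (fps_mul (qpoch 1 (k - i) k) (qpoch 1 k k)))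
     * (1 + 2%:R * divisor_poly N)).
Proof.
rewrite /Sgf; set C := fps_mul (qpoch 1 i k) _.
set B := qpoch 1 1 1; set D := 1 + _.
apply: cong_trans (cong_truncM _ _ _ _) _.
apply: (@cong_trans _ _ _ ((trunc N B * D * trunc N C) * trunc N (fps_inv B))).
  apply: congM (cong_refl _ _ _); apply: cong_trans (cong_truncM _ _ _ _) _.
  exact: congM (cong_qpoch_overpartition N) (cong_refl _ _ _).
have BV : cong 4%:R 'X^N (trunc N (fps_inv B) * trunc N B) 1.
  apply: cong_trans (cong_sym (cong_truncM _ _ _ _)) _.
  apply: cong_coef_eq => j jN.
  by rewrite coef_poly jN coef1 fps_mulV ?[B 0]qpoch0.
(* The factor [B] produced by the numerator cancels against [fps_inv B]. *)
have := congM (cong_refl _ _ (trunc N C * D)) BV.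
by rewrite mulr1; congr cong; ring.
Qed.

Lemma Ski_mod4 (k i n : nat) : (4 %| k)%N -> (4 %| i)%N -> (1 < n %% 4)%N ->
  (Ski k i n = 0 %[mod 4])%Z.
Proof.
move=> k4 i4 n4.
have := cong_coef (cong_trunc_Sgf k i n.+1) (ltnSn n).
rewrite coef_poly ltnSn => ->; apply/eqP; rewrite mod0z; apply/eqP/dvdz_mod0P.
set C := fps_mul _ _.
have C4 : supported 4 C.
  apply: supported_conv; first exact: supported_qpoch.
  by apply: supported_conv; apply: supported_qpoch; rewrite ?dvdn_sub.
rewrite coefM; apply: rpred_sum => j _; rewrite coef_poly.
case: ifP => _; last by rewrite mul0r.
have [j4|/C4->] := boolP (4 %| j)%N; last by rewrite mul0r.
(* Only multiples [j] of 4 survive, so [n - j] keeps the residue of [n]. It is thus nonzero, the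
   constant 1 contributes nothing, and what remains is twice an even number. *)
have nj4 : (1 < (n - j) %% 4)%N.
  by move: (ltn_ord j) n4 j4; lia.
apply: dvdz_mull; rewrite coefD coef1 mulr_natl coefMn.
case: eqP nj4 => [->//|_] nj4; rewrite add0r.
have /dvdzP[q ->] := divisor_poly_even n.+1 nj4.
by rewrite -mulrnAr; apply: dvdz_mull.
Qed.

Theorem mainTheorem7 (k i : nat)
    (hi1 : (1 <= i)%N) (hik : (2 * i <= k)%N)
    (hk4 : k = 0 %[mod 4]) (hi4 : i = 0 %[mod 4]) (n : nat) :
  (Ski k i (4 * n + 2)%N = 0 %[mod 4])%Z /\ (Ski k i (4 * n + 3)%N = 0 %[mod 4])%Z.
Proof.
by split; apply: Ski_mod4; rewrite /dvdn ?hk4 ?hi4 // mulnC modnMDl.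
Qed.
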